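(* Let $p$ be an odd prime and let $H,N$ be integers with $0\le H<H+N<p$. For $a\in\mathbb{F}_p$ let $$S(a,H,N)=\sum_{n=H+1}^{H+N}\mathbf{e}(a\,n!).$$ Then $$\sum_{a=0}^{p-1}|S(a,H,N)|^2\ll pN^{3/2}.$$
   Context: $\mathbf{e}(z)=\exp(2\pi i z/p)$. The implied constant is absolute. *)

(* Defs.v *)
From HB Require Import structures.
From mathcomp Require Export all_boot all_order all_algebra.
From mathcomp Require Export reals sequences exp trigo.
From mathcomp.real_closed Require Export complex.

Set Implicit Arguments.
Unset Strict Implicit.
Unset Printing Implicit Defensive.

Import Order.TTheory GRing.Theory Num.Theory.
Local Open Scope ring_scope.
Local Open Scope complex_scope.

(* The complex exponential, through Euler's formula. *)
Definition cexp (R : realType) (z : R[i]) : R[i] :=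
  (expR (complex.Re z))%:C * (cos (complex.Im z) +i* sin (complex.Im z)).

Definition eexp (R : realType) (p : nat) (z : R) : R[i] :=
  cexp ((2 * pi * z / p%:R) *i).

(* The element [a : 'F_p] is read through its representative in [0, p - 1];
   [eexp p] takes the same value at all integers congruent modulo [p]. *)
Definition fact_expsum (R : realType) (p : nat) (a : 'F_p) (H N : nat) : R[i] :=
  \sum_(H.+1 <= n < (H + N).+1) eexp p ((nat_of_ord a)%:R * (n`!)%:R : R).

(* Main.v *)
(** Orthogonality of the additive characters gives [sum_a |S(a)|^2 = p J], where
    [J] counts the pairs [(m, n)] in the interval with [m! = n! mod p].
    For [k > 0] the congruence [(n + k)! = n! mod p] says that [n] is a root of
    the monic polynomial [(X + 1)...(X + k) - 1], so it has at most [k]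
    solutions.  Cut the interval into [L] blocks of length [L], where [L] is
    about [sqrt N].  By Cauchy-Schwarz, [J] is at most [L] times the number of
    pairs lying moreover in a common block; those have difference less than [L],
    so there are at most [N + 2 L^2] of them.  Hence [J << N^(3/2)]. *)

Require Import Defs.
From mathcomp Require Import zify ring lra.

Set Implicit Arguments.
Unset Strict Implicit.
Unset Printing Implicit Defensive.

Import Order.TTheory GRing.Theory Num.Theory.
Local Open Scope ring_scope.
Local Open Scope complex_scope.

(** * Orthogonality and Parseval for powers of a root of unity *)

Lemma prim_root_norm (C : numClosedFieldType) p (w : C) :
  p.-primitive_root w -> `|w| = 1.
Proof.
move=> w_prim; apply/eqP; rewrite -(@pexpr_eq1 _ _ p) ?normr_ge0 //.
  by rewrite -normrX prim_expr_order // normr1.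
exact: prim_order_gt0 w_prim.
Qed.

(** The sum is geometric with ratio [z = w ^+ m / w ^+ n], where [z ^+ p = 1], and [z = 1] exactly
    when [m] and [n] agree modulo [p]. *)
Lemma prim_root_orthogonality (C : numClosedFieldType) p (w : C) (m n : nat) :
  p.-primitive_root w ->
  \sum_(a < p) w ^+ (a * m) * (w ^+ (a * n))^-1
    = (if m == n %[mod p] then p%:R else 0).
Proof.
move=> w_prim; have w0 : w != 0 by rewrite -normr_eq0 (prim_root_norm w_prim) oner_eq0.
have wn0 k : w ^+ k != 0 by rewrite expf_neq0.
under eq_bigr => a _ do
  rewrite !(mulnC a) !exprM -exprVn -exprMn.
set z := w ^+ m / w ^+ n.
have zE : (z == 1) = (m == n %[mod p]).
  by rewrite -(eq_prim_root_expr w_prim) -(inj_eq (mulIf (wn0 n))) divfK // mul1r.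
have [z1|z1] := eqVneq z 1; rewrite -zE.
  rewrite z1 eqxx; under eq_bigr do rewrite expr1n.
  by rewrite sumr_const card_ord.
rewrite (negPf z1); apply/eqP; have := subrX1 z p.
have -> : z ^+ p = 1.
  rewrite exprMn exprVn exprAC [w ^+ n ^+ p]exprAC (prim_expr_order w_prim).
  by rewrite !expr1n divr1.
rewrite subrr => /esym/eqP; rewrite mulf_eq0 subr_eq0.
by rewrite (negPf z1).
Qed.

Lemma prim_root_parseval (C : numClosedFieldType) p (w : C) (I : finType)
    (f : I -> nat) :
  p.-primitive_root w ->
  \sum_(a < p) `|\sum_i w ^+ (a * f i)| ^+ 2
    = p%:R * (\sum_i \sum_j (f i == f j %[mod p]))%N%:R.
Proof.
move=> w_prim; have w1 k : `|w ^+ k| = 1.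
  by rewrite normrX (prim_root_norm w_prim) expr1n.
transitivity (\sum_i \sum_j \sum_(a < p) w ^+ (a * f i) * (w ^+ (a * f j))^-1).
  under [RHS]eq_bigr do rewrite exchange_big.
  rewrite exchange_big; apply: eq_bigr => a _ /=.
  rewrite normCK rmorph_sum mulr_suml; apply: eq_bigr => i _.
  rewrite mulr_sumr; apply: eq_bigr => j _.
  by rewrite invC_norm w1 expr1n invr1 mul1r.
rewrite natr_sum mulr_sumr; apply: eq_bigr => i _.
rewrite natr_sum mulr_sumr; apply: eq_bigr => j _.
by rewrite prim_root_orthogonality //; case: ifP; rewrite ?mulr1 ?mulr0.
Qed.

(** * The exponential as a primitive root of unity *)

Lemma eexpE (R : realType) p (x : R) :
  eexp p x = cos (2 * pi * x / p%:R) +i* sin (2 * pi * x / p%:R).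
Proof. by rewrite /eexp /cexp /= expR0 mul1r. Qed.

Lemma eexpD (R : realType) p (x y : R) : eexp p (x + y) = eexp p x * eexp p y.
Proof.
rewrite !eexpE mulrDr mulrDl cosD sinD.
by apply/eqP; rewrite eq_complex /= eqxx /= addrC.
Qed.

Lemma eexp_nat (R : realType) p n : eexp p (n%:R : R) = eexp p 1 ^+ n.
Proof.
elim: n => [|n IHn]; last by rewrite -natr1 eexpD IHn exprSr.
by rewrite eexpE mulr0 mul0r cos0 sin0.
Qed.

Lemma eexp_prim_root (R : realType) p :
  prime p -> odd p -> p.-primitive_root (eexp p (1 : R)).
Proof.
move=> p_pr p_odd; have p_gt0 := prime_gt0 p_pr.
have p_neq0 : p%:R != 0 :> R by rewrite pnatr_eq0 -lt0n.
have p_gt2 : 2 < p%:R :> R.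
  by rewrite ltr_nat; case: p p_pr p_odd {p_gt0 p_neq0} => [|[|[|p]]].
have e_p : eexp p (1 : R) ^+ p = 1.
  by rewrite -eexp_nat eexpE mulfK // mulr_natl cos2pi sin2pi.
have [m m_prim m_dvd] := prim_order_exists p_gt0 e_p.
have [_ p_div] := primeP p_pr; move/p_div: m_dvd => /orP[] /eqP m_eq.
  (* Order 1 would force [sin (2 * pi / p)] to vanish, but [p > 2] puts this angle strictly between
     0 and [pi]. *)
  move: m_prim; rewrite m_eq => /prim_expr_order; rewrite expr1 eexpE => -[_ sin0].
  have : 0 < sin (2 * pi * 1 / p%:R : R); last by rewrite sin0 ltxx.
  apply: sin_gt0_pi; have pi_pos := pi_gt0 R.
  rewrite mulr1 divr_gt0 ?mulr_gt0 ?ltr0n //=.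
  by rewrite ltr_pdivrMr ?ltr0n // [ltRHS]mulrC ltr_pM2r.
by move: m_prim; rewrite m_eq.
Qed.

(** * Cauchy-Schwarz for collision counts *)

Lemma sqr_sum_leq (I : finType) (x : I -> nat) :
  ((\sum_i x i) ^ 2 <= #|I| * \sum_i x i ^ 2)%N.
Proof.
rewrite -(leq_pmul2l (isT : 0 < 2)%N).
have -> : (2 * (#|I| * \sum_i x i ^ 2) =
    \sum_i \sum_j (x i ^ 2 + x j ^ 2))%N.
  under [RHS]eq_bigr do rewrite big_split /= sum_nat_const.
  by rewrite big_split /= sum_nat_const -big_distrr /= mul2n addnn.
rewrite -mulnn big_distrlr /= big_distrr /=; apply: leq_sum => i _.
rewrite big_distrr /=; apply: leq_sum => j _.
exact: (nat_Cauchy (x i) (x j)).1.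
Qed.

Lemma sum_class_sqr (I T : finType) (f : I -> T) :
  (\sum_i \sum_j (f i == f j) = \sum_t (\sum_i (f i == t)) ^ 2)%N.
Proof.
under [RHS]eq_bigr do rewrite -mulnn big_distrlr /=.
rewrite [RHS]exchange_big /=; apply: eq_bigr => i _.
rewrite exchange_big /=; apply: eq_bigr => j _.
rewrite (bigD1 (f i)) //= eqxx mul1n big1 ?addn0 1?eq_sym // => t.
by rewrite eq_sym => /negPf ->.
Qed.

(** The map [b] cuts each fibre of [f] into at most [#|B|] pieces; Cauchy-Schwarz compares the
    square of the fibre's size with the squares of the sizes of its pieces. *)
Lemma collisions_refine (I T B : finType) (f : I -> T) (b : I -> B) :
  (\sum_i \sum_j (f i == f j)
     <= #|B| * \sum_i \sum_j ((f i == f j) && (b i == b j)))%N.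
Proof.
have -> : (\sum_i \sum_j ((f i == f j) && (b i == b j)) =
   \sum_t \sum_c (\sum_i ((f i, b i) == (t, c))) ^ 2)%N.
  rewrite [RHS]pair_big /=.
  transitivity (\sum_u (\sum_i ((f i, b i) == u)) ^ 2)%N.
    by rewrite -sum_class_sqr.
  by apply: eq_bigr => -[].
rewrite sum_class_sqr big_distrr /=; apply: leq_sum => t _.
apply: leq_trans (sqr_sum_leq _).
rewrite leq_sqr exchange_big /=; apply: leq_sum => i _.
by rewrite (bigD1 (b i)) //= xpair_eqE eqxx andbT leq_addr.
Qed.

(** * Collisions of factorials modulo a prime *)

Lemma card_prod_shift_eq1 (F : finFieldType) k :
  (0 < k)%N ->
  (#|[set x : F | (\prod_(j < k) (x + j.+1%:R) == 1)%R]| <= k)%N.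
Proof.
move=> k_gt0; pose g := \prod_(j < k) ('X - (- j.+1%:R : F)%:P).
have size_g : size g = k.+1.
  by rewrite size_prod_XsubC [index_enum _]unlock -enumT size_enum_ord.
(* As [k > 0], subtracting the constant 1 leaves the degree unchanged. *)
have size_g1 : size (g - 1) = k.+1.
  by rewrite size_polyDl size_g // size_polyN size_poly1 ltnS.
rewrite -ltnS -size_g1 cardE max_poly_roots ?enum_uniq //.
  by rewrite -size_poly_eq0 size_g1.
apply/allP => x; rewrite mem_enum inE => /eqP prod1.
rewrite rootE hornerD hornerN hornerC horner_prod subr_eq0 -[X in _ == X]prod1.
apply/eqP/eq_bigr => j _; by rewrite hornerXsubC opprK.
Qed.

Lemma natr_Fp_eq p m n : prime p ->
  (m%:R == n%:R :> 'F_p) = (m == n %[mod p]).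
Proof. by move=> p_pr; rewrite -val_eqE /= !val_Fp_nat. Qed.

Lemma fact_shift n k : ((n + k)`! = n`! * \prod_(j < k) (n + j.+1))%N.
Proof.
elim: k => [|k IHk]; first by rewrite addn0 big_ord0 muln1.
by rewrite addnS factS IHk big_ord_recr /= mulnC mulnA addnS.
Qed.

(** Since [n < p], the factor [n!] is a unit modulo [p] and cancels. *)
Lemma fact_shift_eq_mod p n k : prime p -> (n < p)%N ->
  (n + k)`! = n`! %[mod p] ->
  \prod_(j < k) ((n%:R : 'F_p) + j.+1%:R) = 1.
Proof.
move=> p_pr n_ltp /eqP; rewrite -natr_Fp_eq // fact_shift natrM natr_prod.
have fact_neq0 : n`!%:R != 0 :> 'F_p.
  elim: n n_ltp => [|n IHn] n_ltp; first exact: oner_neq0.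
  rewrite factS natrM mulf_neq0 ?IHn 1?ltnW //.
  by rewrite (natr_Fp_eq _ 0) // mod0n modn_small.
rewrite -[X in _ == X]mulr1 (inj_eq (mulfI fact_neq0)) => /eqP prod1.
by rewrite -[RHS]prod1; apply: eq_bigr => j _; rewrite natrD.
Qed.

(** Such a pair is determined by its first index [i]. Since [H + N < p], the residue of [H + 1 + i]
    determines [i], and this residue is a root of a polynomial of degree [k]. *)
Lemma fact_collisions_shift p H N k : prime p -> (H + N < p)%N -> (0 < k)%N ->
  (\sum_(i < N) \sum_(j < N)
     (((H.+1 + i)`! == (H.+1 + j)`! %[mod p]) && (j == i + k :> nat)) <= k)%N.
Proof.
move=> p_pr HN_ltp k_gt0.
pose A := [pred u : 'I_N * 'I_N |
  ((H.+1 + u.1)`! == (H.+1 + u.2)`! %[mod p]) && (u.2 == u.1 + k :> nat)%N].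
have -> : (\sum_(i < N) \sum_(j < N)
    (((H.+1 + i)`! == (H.+1 + j)`! %[mod p]) && (j == i + k :> nat)) = #|A|)%N.
  rewrite pair_big /= -sum1_card [RHS]big_mkcond /=.
  by apply: eq_bigr => u _; rewrite inE; case: (_ && _).
pose h (u : 'I_N * 'I_N) : 'F_p := (H.+1 + u.1)%:R.
have h_inj : {in A &, injective h}.
  move=> [i j] [i' j']; rewrite !inE /h /= => /andP[_ /eqP jE] /andP[_ /eqP j'E].
  move/eqP; rewrite natr_Fp_eq // !modn_small ?eqn_add2l; first 1 last.
  - by have := ltn_ord i'; lia.
  - by have := ltn_ord i; lia.
  move=> /eqP ii'; congr pair; apply: val_inj => //=.
  by rewrite jE j'E ii'.
rewrite -(card_in_imset h_inj) (leq_trans _ (card_prod_shift_eq1 'F_p k_gt0)) //.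
apply/subset_leq_card/subsetP => x /imsetP[[i j] ij_A ->{x}].
move: ij_A; rewrite !inE /h /= => /andP[/eqP fact_eq /eqP jE]; apply/eqP.
apply: fact_shift_eq_mod => //; first by have := ltn_ord i; lia.
by rewrite -addnA -jE -fact_eq.
Qed.

Lemma fact_close_collisions p H N L : prime p -> (H + N < p)%N -> (0 < L)%N ->
  (\sum_(i < N) \sum_(j < N)
     (((H.+1 + i)`! == (H.+1 + j)`! %[mod p]) && (i %/ L == j %/ L))
   <= N + 2 * L ^ 2)%N.
Proof.
move=> p_pr HN_ltp L_gt0.
pose e (i j : 'I_N) := (H.+1 + i)`! == (H.+1 + j)`! %[mod p].
(* [s i j] is 1 if the pair collides and [1 <= j - i <= L], and 0 otherwise. Each of the [L] shifts
   contributes at most [L], hence the bound [L ^ 2]. *)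
pose s (i j : 'I_N) := (\sum_(k < L) (e i j && (j == i + k.+1 :> nat)))%N.
have s_sum : (\sum_(i < N) \sum_(j < N) s i j <= L ^ 2)%N.
  under eq_bigr do rewrite exchange_big /=.
  rewrite exchange_big /= -mulnn.
  rewrite -[X in (_ <= X * _)%N]card_ord -sum_nat_const; apply: leq_sum => k _.
  exact: leq_trans (fact_collisions_shift p_pr HN_ltp (ltn0Sn k)) (ltn_ord k).
have s_gt0 i j : e i j -> (i < j)%N -> (i %/ L = j %/ L)%N -> (0 < s i j)%N.
  move=> e_ij lt_ij eq_ij.
  (* Two indices with the same quotient by [L] differ by less than [L]. *)
  have k_lt : ((j - i).-1 < L)%N.
    have := divn_eq i L; have := divn_eq j L; rewrite eq_ij.
    by have := ltn_pmod j L_gt0; lia.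
  rewrite /s (bigD1 (Ordinal k_lt)) //= e_ij.
  by rewrite prednK ?subn_gt0 // subnKC ?eqxx // ltnW.
have -> : (N + 2 * L ^ 2 = \sum_(i < N) \sum_(j < N) (i == j) + (L ^ 2 + L ^ 2))%N.
  rewrite mul2n addnn; congr addn.
  rewrite -[LHS]card_ord -sum1_card; apply: eq_bigr => i _.
  rewrite (bigD1 i) //= eqxx big1 // => j.
  by rewrite eq_sym => /negPf ->.
(* A pair in a common block is diagonal, or counted by [s] in one of its two orders. *)
apply: (@leq_trans (\sum_(i < N) \sum_(j < N) ((i == j) + (s i j + s j i)))%N).
  apply: leq_sum => i _; apply: leq_sum => j _.
  case: (boolP (_ && _)) => // /andP[e_ij /eqP eq_ij].
  case: (ltngtP i j) => [lt_ij|lt_ji|/val_inj ->]; last by rewrite eqxx.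
    by have := s_gt0 i j e_ij lt_ij eq_ij; lia.
  have e_ji : e j i by rewrite /e eq_sym.
  by have := s_gt0 j i e_ji lt_ji (esym eq_ij); lia.
under eq_bigr do rewrite big_split /= big_split /=.
rewrite big_split big_split /= leq_add2l leq_add //.
by rewrite exchange_big.
Qed.

Lemma fact_collisions p H N L : prime p -> (H + N < p)%N -> (N <= L ^ 2)%N ->
  (0 < L)%N ->
  (\sum_(i < N) \sum_(j < N) ((H.+1 + i)`! == (H.+1 + j)`! %[mod p])
   <= L * (N + 2 * L ^ 2))%N.
Proof.
move=> p_pr HN_ltp N_le L_gt0.
have block_lt (i : 'I_N) : (i %/ L < L)%N.
  by rewrite ltn_divLR // mulnn (leq_trans (ltn_ord i)).
(* Residues are taken in ['I_p], so that congruence becomes equality of values in a finite type. *)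
pose f (i : 'I_N) := Ordinal (ltn_pmod (H.+1 + i)`! (prime_gt0 p_pr)).
have := collisions_refine f (fun i => Ordinal (block_lt i)).
rewrite card_ord => /leq_trans -> //.
by rewrite leq_mul2l (fact_close_collisions p_pr HN_ltp L_gt0) orbT.
Qed.

(** * The second moment and the final bound *)

Lemma fact_expsum_parseval (R : realType) p H N : prime p -> odd p ->
  \sum_(a : 'F_p) `|fact_expsum R a H N| ^+ 2
    = p%:R * (\sum_(i < N) \sum_(j < N)
                ((H.+1 + i)`! == (H.+1 + j)`! %[mod p]))%N%:R.
Proof.
move=> p_pr p_odd.
rewrite -(prim_root_parseval _ (eexp_prim_root R p_pr p_odd)).
(* Stating the summand on [nat] allows passing from the index type ['F_p] to ['I_p]. *)
pose F (a : nat) := `|\sum_(i < N) eexp p (1 : R) ^+ (a * (H.+1 + i)`!)| ^+ 2.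
transitivity (\sum_(a : 'F_p) F a); last first.
  by rewrite -(big_mkord xpredT F) Fp_cast // big_mkord.
apply: eq_bigr => a _; rewrite /F /fact_expsum; congr (`|_| ^+ 2).
rewrite -addSn -{1}[H.+1]add0n big_addn addKn big_mkord.
by apply: eq_bigr => i _; rewrite -natrM eexp_nat addnC.
Qed.

Lemma ex_sqrtn n : exists k, (k ^ 2 <= n < k.+1 ^ 2)%N.
Proof.
elim: n => [|n [k /andP[le_kn lt_nk]]]; first by exists 0%N.
have [eq_nk|ne_nk] := eqVneq n.+1 (k.+1 ^ 2)%N; last by exists k; lia.
by exists k.+1; nia.
Qed.

Lemma powR_three_halves (R : realType) (x : R) :
  0 <= x -> x `^ (3 / 2) = x * Num.sqrt x.
Proof.
move=> x_ge0; have -> : 3 / 2 = 1 + 2^-1 :> R by field.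
rewrite powRD; last by apply/implyP => /eqP; lra.
by rewrite powRr1 // powR12_sqrt.
Qed.

Theorem theorem5 (R : realType) :
  exists2 C : R, 0 < C &
    forall p H N : nat,
      prime p -> odd p -> (H < H + N < p)%N ->
      \sum_(a : 'F_p) `|fact_expsum R a H N| ^+ 2
        <= (C * (p%:R * N%:R `^ (3 / 2)))%:C.
Proof.
(* The blocks have length [k + 1], with [k] the integer square root of [N]. As [k >= 1],
   [k + 1 <= 2 k] and [(k + 1)^2 <= 4 k^2 <= 4 N], so [(k + 1) (N + 2 (k + 1)^2) <= 2 k * 9 N = 18 N
   k]. *)
exists 18; first by [].
move=> p H N p_pr p_odd /andP[N_gt0 HN_ltp].
have [k /andP[le_kN lt_Nk]] := ex_sqrtn N.
have k_gt0 : (0 < k)%N by case: k le_kN lt_Nk => //; lia.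
rewrite fact_expsum_parseval //.
have := fact_collisions p_pr HN_ltp (ltnW lt_Nk) (ltn0Sn k).
set J := (\sum_(i < N) _)%N => J_le.
have J_le_kN : (J <= 18 * (N * k))%N by apply: leq_trans J_le _; nia.
have k_le : k%:R <= Num.sqrt (N%:R : R).
  by rewrite -[k%:R]ger0_norm ?ler0n // -sqrtr_sqr ler_wsqrtr // -natrX ler_nat.
have -> : p%:R * J%:R = (p%:R * J%:R)%:C :> R[i] by rewrite rmorphM /= !rmorph_nat.
rewrite lecR powR_three_halves ?ler0n // mulrCA ler_wpM2l ?ler0n //.
apply: (@le_trans _ _ (18 * (N * k))%N%:R); first by rewrite ler_nat.
by rewrite !natrM ler_wpM2l // ler_wpM2l.
Qed.
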